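(* There exist absolute constants $c_1,c_2,c_3>0$ such that the following holds. Let $n,m\ge 1$ be integers, let $M\in\mathbb{R}^{n\times m}$ be a non-zero matrix, and let $\psi\in\{\pm1\}^{n}$ and $\xi\in\{\pm1\}^{m}$ be independent Rademacher vectors. Then for every integer $r\in\{1,\dots,n\}$, $$\sup_{x\in\mathbb{R}}\mathbb{P}\left\{\mathrm{Res}_x^M(\psi,\xi)\le r\right\}\;\le\; c_1\, r\cdot f(M,n)+c_2\, r\cdot g(M,r)+\exp\left(-c_3\,\mathrm{sr}(M)\right).$$
   Context: A Rademacher vector is a random vector whose entries are i.i.d. and uniform on $\{-1,1\}$. Resilience: for $M\in\mathbb{R}^{n\times m}$, $x\in\mathbb{R}$, $\psi\in\{\pm1\}^n$, $\xi\in\{\pm1\}^m$, let $\mathrm{Res}_x^M(\psi,\xi)$ be the least total number of sign flips of entries of $\psi$ and $\xi$ needed to reach a pair $(\psi',\xi')\in\{\pm1\}^n\times\{\pm1\}^m$ with $(\psi')^{\mathsf T}M\xi'=x$; that is, the Hamming distance from $(\psi,\xi)$, viewed as a vector in $\{\pm1\}^{n+m}$, to the level set $\{(\psi',\xi'):(\psi')^{\mathsf T}M\xi'=x\}$. It equals $+\infty$ if this level set is empty. Matrix quantities: $\|M\|_\infty=\max_{i,j}|M_{ij}|$; $\|M\|_{\infty,2}$ is the maximum Euclidean norm of a row of $M$; $\|M\|_{\infty,0}$ is the maximum number of non-zero entries in a row of $M$; $\|M\|_{\mathsf F}$ is the Frobenius norm; $\|M\|_2$ is the spectral norm; $\mathrm{sr}(M)=\|M\|_{\mathsf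 F}^2/\|M\|_2^2$ is the stable rank. Set $$\mathrm{maxsupp}(M)=\max\{\|M\|_{\infty,0},\|M^{\mathsf T}\|_{\infty,0}\},\qquad \mathrm{maxdiam}(M)=\max\{\|M\|_{\infty,2},\|M^{\mathsf T}\|_{\infty,2}\},$$ $$f(M,n)=\frac{\min\{\mathrm{maxsupp}(M)\cdot\|M\|_\infty,\ \sqrt{\log n}\cdot\mathrm{maxdiam}(M)\}}{\|M\|_{\mathsf F}},\qquad g(M,r)=\frac{\min\{r,\mathrm{maxsupp}(M)\}\cdot\|M\|_\infty}{\|M\|_{\mathsf F}}.$$ *)

(* Defs.v *)
From HB Require Import structures.
From mathcomp Require Import all_boot all_order all_algebra.
From mathcomp Require Import all_classical all_reals all_analysis.

Set Implicit Arguments.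
Unset Strict Implicit.
Unset Printing Implicit Defensive.

Import Order.TTheory GRing.Theory Num.Theory.
Import numFieldNormedType.Exports.

Local Open Scope classical_set_scope.
Local Open Scope ring_scope.

Definition mutually_independent d (T : measurableType d) (R : realType)
    (P : probability T R) d' (T' : measurableType d') (I : finType)
    (X : I -> T -> T') : Prop :=
  forall (J : {set I}) (A : I -> set T'),
    (forall i, i \in J -> measurable (A i)) ->
    P (\bigcap_(i in [set` J]) (X i @^-1` A i)) =
      (\prod_(i in J) P (X i @^-1` A i))%E.

Definition independent2 d (T : measurableType d) (R : realType)
    (P : probability T R) d1 (T1 : measurableType d1)
    d2 (T2 : measurableType d2)
    (X : {RV P >-> T1}) (Y : {RV P >-> T2}) : Prop :=
  forall (A : set T1) (B : set T2), measurable A -> measurable B ->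
    P (X @^-1` A `&` Y @^-1` B) = (P (X @^-1` A) * P (Y @^-1` B))%E.

(* The entries are only required to lie in {-1, 1} almost surely, which the
   two point probabilities imply. *)
Definition rademacher d (T : measurableType d) (R : realType)
    (P : probability T R) n (psi : {RV P >-> n.-tuple R}) : Prop :=
  mutually_independent P (fun (i : 'I_n) w => tnth (psi w) i) /\
  forall i : 'I_n, P [set w | tnth (psi w) i = 1] = (2^-1)%:E /\
                   P [set w | tnth (psi w) i = -1] = (2^-1)%:E.

Definition sign_vector (R : realType) n (u : n.-tuple R) : Prop :=
  forall i : 'I_n, tnth u i = 1 \/ tnth u i = -1.

Definition hamming (R : realType) n (u v : n.-tuple R) : nat :=
  #|[pred i : 'I_n | tnth u i != tnth v i]|.

Definition bilin (R : realType) n m (M : 'M[R]_(n, m))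
    (u : n.-tuple R) (v : m.-tuple R) : R :=
  ((\row_i tnth u i) *m M *m (\col_j tnth v j)) 0 0.

(* [ereal_inf] of the empty set is [+oo]. *)
Definition Res (R : realType) n m (M : 'M[R]_(n, m)) (x : R)
    (psi : n.-tuple R) (xi : m.-tuple R) : \bar R :=
  ereal_inf [set e | exists (psi' : n.-tuple R) (xi' : m.-tuple R),
    [/\ sign_vector psi', sign_vector xi', bilin M psi' xi' = x &
        e = (hamming psi psi' + hamming xi xi')%:R%:E]].

Section matrix_quantities.
Variable R : realType.

Definition max_entry n m (M : 'M[R]_(n, m)) : R :=
  \big[Num.max/(0 : R)]_(i < n) \big[Num.max/(0 : R)]_(j < m) `|M i j|.

(* On row and column vectors this is the Euclidean norm. *)
Definition frobenius n m (M : 'M[R]_(n, m)) : R :=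
  Num.sqrt (\sum_(i < n) \sum_(j < m) M i j ^+ 2).

Definition max_row_norm n m (M : 'M[R]_(n, m)) : R :=
  \big[Num.max/(0 : R)]_(i < n) frobenius (row i M).

Definition max_row_supp n m (M : 'M[R]_(n, m)) : nat :=
  \max_(i < n) #|[pred j : 'I_m | M i j != 0%R]|.

Definition spectral_norm n m (M : 'M[R]_(n, m)) : R :=
  sup [set frobenius (M *m v) | v in [set v : 'cV[R]_m | frobenius v = 1]].

Definition stable_rank n m (M : 'M[R]_(n, m)) : R :=
  frobenius M ^+ 2 / spectral_norm M ^+ 2.

Definition maxsupp n m (M : 'M[R]_(n, m)) : nat :=
  maxn (max_row_supp M) (max_row_supp M^T).

Definition maxdiam n m (M : 'M[R]_(n, m)) : R :=
  Num.max (max_row_norm M) (max_row_norm M^T).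

Definition f_param n m (M : 'M[R]_(n, m)) (k : nat) : R :=
  Num.min ((maxsupp M)%:R * max_entry M) (Num.sqrt (ln k%:R) * maxdiam M)
    / frobenius M.

Definition g_param n m (M : 'M[R]_(n, m)) (r : nat) : R :=
  (minn r (maxsupp M))%:R * max_entry M / frobenius M.

End matrix_quantities.

(* Main.v *)
Require Import Defs.
From mathcomp Require Import all_boot all_order all_algebra.
From mathcomp Require Import all_classical all_reals all_analysis.
From mathcomp Require Import ring lra.

(** Write [N] for the Frobenius norm of [M], [B] for its largest entry, and
    condition on the sign vector [t] of the columns: [s^T M t] is then a
    Rademacher sum with coefficient vector [M t].

    Three facts carry the proof. First, [|M t| >= N / 2] except with probability
    [exp (- sr(M) / 8)] ([sqnorm_lower_tail]): for a form [0 <= A <= I] the bound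
    [E exp (- t^T A t / 2) <= exp (- tr A / 4)] follows by averaging out one sign
    at a time, since each step leaves a form of the same kind
    ([mean_expRN_qf]). Second, a Rademacher sum whose coefficients are at most [T]
    falls in a given interval of radius [T] with probability at most
    [64 * T / |w|] ([small_ball]), by Esseen's argument with a discrete Fejer
    kernel. Third, if all coordinates of [M t] and [M^T s] are at most [K], then
    [r] flips change [s^T M t] by at most [r (2 K + 4 min(r, maxsupp) B)]
    ([sign_bilin_flip_le]). Together they bound the probability of resilience at
    most [r] by a constant times [r (K + min(r, maxsupp) B) / N], plus the
    exponential and the probability that some coordinate exceeds [K]
    ([mean_reachable_le]).

    It remains to choose [K]. The value [maxsupp * B] never fails. The value
    [2 sqrt(log n) maxdiam] fails with probability at most [4 / n] by Hoeffding's
    inequality, even if there are far more columns than rows: the columns have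
    total squared norm at most [n maxdiam^2], and short columns are so unlikely to
    exceed [K] that a union bound costs only this total ([hoeffding_family]). As
    [N <= sqrt(n) maxdiam], the [4 / n] is absorbed by [f]. For [n = 1] the
    logarithm vanishes and the bound comes from conditioning on the single row
    sign instead ([mean_reachable_one_row]).

    Everything is counted on finite sign patterns; [probability_Res_le] passes
    from the given random vectors to this count. *)

Set Implicit Arguments.
Unset Strict Implicit.
Unset Printing Implicit Defensive.

Import Order.TTheory GRing.Theory Num.Theory.
Import numFieldNormedType.Exports.

Local Open Scope classical_set_scope.
Local Open Scope ring_scope.

(** * Scalar inequalities *)

Section scalar_inequalities.
Variable R : realType.
Implicit Types x y b : R.

Lemma eqW x y : x = y -> x <= y.
Proof. by move=> ->. Qed.

Lemma ge_at0_of_derive_ge0 (f df : R -> R) b x :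
  (forall y, is_derive y 1 f (df y)) ->
  (forall y, 0 <= y <= b -> 0 <= df y) -> 0 <= x <= b -> f 0 <= f x.
Proof.
move=> fdf df0 /andP[x0 xb].
have cf : {within `[0, x], continuous f}.
  by apply: derivable_within_continuous => y _; apply: ex_derive.
have [c] := MVT_segment x0 (fun y _ => fdf y) cf.
rewrite in_itv/= => /andP[c0 cx] fE.
rewrite -subr_ge0 fE subr0 mulr_ge0// df0// c0/=.
exact: le_trans cx xb.
Qed.

Lemma cosh_le_expR x : (expR x + expR (- x)) / 2 <= expR (x ^+ 2 / 2).
Proof.
wlog x0 : x / 0 <= x.
  move=> H; have [/H//|xlt0] := leP 0 x.
  have := H (- x); rewrite opprK sqrrN addrC; apply.
  by rewrite oppr_ge0 ltW.
(* [psi] is, up to a positive factor, minus the logarithmic derivative of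
   cosh(y) exp(-y^2/2); it is nonnegative as psi'(y) = y (e^y - e^-y). *)
pose psi (y : R) := y * (expR y + expR (- y)) - (expR y - expR (- y)).
have psi_ge0 y : 0 <= y -> 0 <= psi y.
  move=> y0.
  have -> : 0 = psi 0 by rewrite /psi oppr0 mul0r subrr subr0.
  apply: (@ge_at0_of_derive_ge0 _
    (fun z => z * (expR z - expR (- z))) y) => [z|z /andP[z0 _]|].
  - by rewrite /psi; apply: trigger_derive; rewrite /GRing.scale/=; ring.
  - by rewrite /= mulr_ge0// subr_ge0 ler_expR; lra.
  - by rewrite y0 lexx.
pose phi (y : R) := - ((expR y + expR (- y)) * expR (- (2^-1 * y ^+ 2))).
have : phi 0 <= phi x.
  apply: (@ge_at0_of_derive_ge0 _
    (fun z => psi z * expR (- (2^-1 * z ^+ 2))) x) => [z|z /andP[z0 _]|].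
  - by rewrite /phi; apply: trigger_derive; rewrite /GRing.scale/= /psi; field.
  - by rewrite /= mulr_ge0 ?expR_ge0 ?psi_ge0.
  - by rewrite x0 lexx.
rewrite /phi expr0n/= mulr0 oppr0 expR0 lerN2 mulr1.
rewrite (expRN (2^-1 * _)) ler_pdivrMr ?expR_gt0// [x ^+ 2 / 2]mulrC.
by lra.
Qed.

Lemma sin_le_id x : 0 <= x -> sin x <= x.
Proof.
move=> x0; rewrite -subr_ge0.
have -> : 0 = (0 : R) - sin 0 by rewrite sin0 subr0.
apply: (@ge_at0_of_derive_ge0 (fun y => y - sin y) (fun y => 1 - cos y) x).
- by move=> y _; rewrite subr_ge0 cos_le1.
- by rewrite x0 lexx.
Qed.

Lemma cos_ge_quadratic x : 1 - x ^+ 2 / 2 <= cos x.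
Proof.
wlog x0 : x / 0 <= x.
  move=> H; have [/H//|xlt0] := leP 0 x.
  by have := H (- x); rewrite cosN sqrrN; apply; rewrite oppr_ge0 ltW.
have : cos 0 - 1 + 2^-1 * 0 ^+ 2 <= cos x - 1 + 2^-1 * x ^+ 2.
  apply: (@ge_at0_of_derive_ge0 (fun y => cos y - 1 + 2^-1 * y ^+ 2)
    (fun y => y - sin y) x) => [y|y /andP[y0 _]|].
  - by move=> /=; apply: trigger_derive; rewrite /GRing.scale/=; field.
  - by rewrite /= subr_ge0 sin_le_id.
  - by rewrite x0 lexx.
by rewrite cos0 expr0n/=; lra.
Qed.

Lemma sin_ge_half x : 0 <= x <= 1 -> x / 2 <= sin x.
Proof.
move=> x01.
have : sin 0 - 2^-1 * 0 <= sin x - 2^-1 * x.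
  apply: (@ge_at0_of_derive_ge0 (fun y => sin y - 2^-1 * y)
    (fun y => cos y - 2^-1) 1) => // [y|y /andP[y0 y1]].
  - by move=> /=; apply: trigger_derive; rewrite /GRing.scale/=; ring.
  - have := cos_ge_quadratic y; nra.
by rewrite sin0; lra.
Qed.

Lemma cos_le_expR x : `|x| <= 1 -> cos x <= expR (- (x ^+ 2 / 4)).
Proof.
move=> x1; apply: (@le_trans _ _ (1 - x ^+ 2 / 4)); last exact: expR_ge1Dx.
wlog x0 : x x1 / 0 <= x.
  move=> H; have [/H->//|xlt0] := leP 0 x.
  by have := H (- x); rewrite cosN sqrrN normrN oppr_ge0; apply => //; exact: ltW.
rewrite ger0_norm// in x1.
have : - cos 0 - 4^-1 * 0 ^+ 2 <= - cos x - 4^-1 * x ^+ 2.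
  apply: (@ge_at0_of_derive_ge0 (fun y => - cos y - 4^-1 * y ^+ 2)
    (fun y => sin y - y / 2) 1) => [y|y y01|].
  - by move=> /=; apply: trigger_derive; rewrite /GRing.scale/=; field.
  - by rewrite /= subr_ge0 sin_ge_half.
  - by rewrite x0 x1.
by rewrite cos0 expr0n/=; lra.
Qed.

(** On [0 < u <= 1] the Gaussian tail [exp (- a / u)], as a function of the
    variance [u], lies below its chord. This lets a union bound over many
    columns be paid by their total squared norm instead of by their number. *)
Lemma expRN_div_le (a u : R) : 1 <= a -> 0 < u <= 1 ->
  expR (- (a / u)) <= u * expR (- a).
Proof.
move=> a1 /andP[u0 u1].
have -> : u = expR (ln u) by rewrite lnK.
rewrite -expRD ler_expR lnK//.
have h : - ln u <= u^-1 - 1.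
  rewrite -lnV//; have := expR_ge1Dx (ln u^-1); rewrite lnK ?posrE ?invr_gt0//; lra.
have v1 : 0 <= u^-1 - 1 by rewrite subr_ge0 -invr1 lef_pV2 ?posrE.
nra.
Qed.

(** The hypothesis [1 <= a] of the previous lemma is met with [a = 2 ln n]. *)
Lemma ln_nat_ge_half n : (1 < n)%N -> 1 / 2 <= ln n%:R :> R.
Proof.
move=> n1.
have h2 : (1 / 2 : R) <= ln 2.
  have := expR_ge1Dx (ln (2^-1) : R).
  by rewrite lnK ?posrE ?invr_gt0// lnV ?posrE//; lra.
by apply: le_trans h2 _; rewrite ler_ln ?posrE ?ltr0n ?ler_nat// (ltn_trans _ n1).
Qed.

End scalar_inequalities.

(** * Averages over sign patterns and Hoeffding bounds *)

Section sign_patterns.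
Variable R : realType.

(** The Rademacher law on [I]: sign patterns are encoded as boolean functions
    so that they form a finite type and expectations are finite sums. *)
Definition sg (b : bool) : R := (-1) ^+ b.

Definition mean (I : finType) (F : {ffun I -> bool} -> R) : R :=
  (\sum_s F s) / 2 ^+ #|I|.

Definition dot (I : finType) (w : I -> R) (s : {ffun I -> bool}) : R :=
  \sum_i w i * sg (s i).

Definition sqnorm (I : finType) (w : I -> R) : R := \sum_i w i ^+ 2.

Lemma sg_sqr b : sg b ^+ 2 = 1.
Proof. by rewrite /sg -exprM mulnC exprM sqrrN !expr1n. Qed.

Lemma norm_sg b : `|sg b| = 1.
Proof. by rewrite /sg normrX normrN1 expr1n. Qed.

Section mean_theory.
Variable I : finType.
Implicit Types F G : {ffun I -> bool} -> R.

Lemma le_mean F G : (forall s, F s <= G s) -> mean F <= mean G.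
Proof. by move=> FG; rewrite ler_wpM2r ?invr_ge0 ?exprn_ge0// ler_sum. Qed.

Lemma eq_mean F G : F =1 G -> mean F = mean G.
Proof. by move=> FG; congr (_ / _); apply: eq_bigr. Qed.

Lemma meanD F G : mean (fun s => F s + G s) = mean F + mean G.
Proof. by rewrite /mean big_split mulrDl. Qed.

Lemma meanZ c F : mean (fun s => c * F s) = c * mean F.
Proof. by rewrite /mean -mulr_sumr mulrA. Qed.

Lemma mean_sum (J : Type) (r : seq J) (P : pred J)
    (F : J -> {ffun I -> bool} -> R) :
  mean (fun s => \sum_(j <- r | P j) F j s) = \sum_(j <- r | P j) mean (F j).
Proof. by rewrite /mean exchange_big mulr_suml. Qed.

Lemma mean_cst c : mean (fun _ : {ffun I -> bool} => c) = c.
Proof.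
rewrite /mean sumr_const card_ffun card_bool -[c *+ _]mulr_natr natrX mulfK//.
Qed.

Lemma mean_prod (h : I -> bool -> R) :
  mean (fun s : {ffun I -> bool} => \prod_i h i (s i)) =
    \prod_i ((h i true + h i false) / 2).
Proof.
rewrite /mean -(bigA_distr_bigA h) big_split/= prodr_const exprVn.
by congr (_ * _); apply: eq_bigr => i _; rewrite big_bool.
Qed.

Lemma mean_expR_dot (w : I -> R) :
  mean (fun s => expR (dot w s)) <= expR (sqnorm w / 2).
Proof.
under eq_mean do rewrite /dot expR_sum.
rewrite (mean_prod (fun i b => expR (w i * sg b))) /sqnorm mulr_suml expR_sum.
apply: ler_prod => i _; rewrite /sg expr1 expr0 mulrN1 mulr1 addrC.
by rewrite cosh_le_expR divr_ge0 ?addr_ge0 ?expR_ge0.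
Qed.

(** Hoeffding's inequality; the exponential moment is optimised at [T / v]. *)
Lemma hoeffding (w : I -> R) (v T : R) : 0 < v -> 0 <= T -> sqnorm w <= v ->
  mean (fun s => (T < `|dot w s|)%R%:R) <= 2 * expR (- (T ^+ 2 / (2 * v))).
Proof.
move=> v0 T0 wv; pose l := T / v.
have l0 : 0 <= l by rewrite divr_ge0// ltW.
have dotZ c s : dot (fun i => c * w i) s = c * dot w s.
  by rewrite /dot mulr_sumr; apply: eq_bigr => i _; rewrite mulrA.
have mZ c : c ^+ 2 = l ^+ 2 ->
    mean (fun s => expR (c * dot w s)) <= expR (l ^+ 2 * v / 2).
  move=> cl; rewrite (eq_mean (G := fun s => expR (dot (fun i => c * w i) s))).
    apply: le_trans (mean_expR_dot _) _; rewrite ler_expR ler_wpM2r// /sqnorm.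
    under eq_bigr do rewrite exprMn cl.
    by rewrite -mulr_sumr ler_wpM2l// sqr_ge0.
  by move=> s; rewrite dotZ.
apply: (@le_trans _ _ (mean (fun s => expR (- (l * T)) * expR (l * dot w s)
    + expR (- (l * T)) * expR (- l * dot w s)))).
  apply: le_mean => s; rewrite -!expRD.
  case: ltP => [|_]; last by rewrite addr_ge0 ?expR_ge0.
  have [d0|d0] := leP 0 (dot w s) => Td; last first.
    rewrite ltr0_norm// in Td.
    rewrite ler_wpDl ?expR_ge0// -expR0 ler_expR; nra.
  rewrite ger0_norm// in Td.
  rewrite ler_wpDr ?expR_ge0// -expR0 ler_expR; nra.
rewrite meanD !meanZ -mulrDr.
apply: (@le_trans _ _ (expR (- (l * T)) * (2 * expR (l ^+ 2 * v / 2)))).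
  rewrite ler_wpM2l ?expR_ge0// mulr_natl mulr2n lerD// mZ// sqrrN//.
rewrite mulrCA -expRD; apply: eqW; congr (_ * expR _).
rewrite /l; field; lra.
Qed.

Lemma dot_sqnorm0 (w : I -> R) s : sqnorm w = 0 -> dot w s = 0.
Proof.
move=> /eqP; rewrite psumr_eq0 => [/allP w0|i _]; last exact: sqr_ge0.
rewrite /dot big1// => i _.
by have := w0 i (mem_index_enum _); rewrite sqrf_eq0 => /eqP->; rewrite mul0r.
Qed.

(** The union bound is charged to the squared norms, so that [n] counts their
    total in units of [D ^+ 2] and not the number of vectors in the family. *)
Lemma hoeffding_family (J : finType) (w : J -> I -> R) (D : R) (n : nat) :
  (1 < n)%N -> 0 < D -> (forall j, sqnorm (w j) <= D ^+ 2) ->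
  \sum_j sqnorm (w j) <= n%:R * D ^+ 2 ->
  mean (fun s => [exists j, 2 * Num.sqrt (ln n%:R) * D < `|dot (w j) s|]%R%:R)
    <= 2 / n%:R.
Proof.
move=> n1 D0 wD sw.
have n0 : 0 < n%:R :> R by rewrite ltr0n (ltn_trans _ n1).
have ln1 := ln_nat_ge_half R n1.
set T := _ * D.
have T0 : 0 <= T by rewrite !mulr_ge0 ?sqrtr_ge0 ?ltW.
have D2 : 0 < D ^+ 2 by rewrite exprn_gt0.
apply: (@le_trans _ _ (mean (fun s => \sum_j (T < `|dot (w j) s|)%R%:R))).
  apply: le_mean => s; case: existsP => [[j Tj]|_]; last exact: sumr_ge0.
  by rewrite (bigD1 j)//= Tj lerDl sumr_ge0.
rewrite mean_sum.
apply: (@le_trans _ _ (\sum_j (sqnorm (w j) / D ^+ 2 * (2 / n%:R ^+ 2)))).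
  apply: ler_sum => j _.
  have wj0 : 0 <= sqnorm (w j) by apply: sumr_ge0 => i _; exact: sqr_ge0.
  have [w0|wn0] := eqVneq (sqnorm (w j)) 0.
    under eq_mean do rewrite dot_sqnorm0// normr0 ltNge T0.
    by rewrite mean_cst w0 !mul0r.
  have wgt0 : 0 < sqnorm (w j) by rewrite lt_def wn0.
  apply: le_trans (hoeffding wgt0 T0 (lexx _)) _.
  have -> : T ^+ 2 / (2 * sqnorm (w j)) = 2 * ln n%:R / (sqnorm (w j) / D ^+ 2).
    rewrite /T !exprMn sqr_sqrtr ?ln_ge0 ?ler1n ?(ltnW n1)//.
    by field; rewrite wn0 !gt_eqF.
  have -> : sqnorm (w j) / D ^+ 2 * (2 / n%:R ^+ 2) =
      2 * (sqnorm (w j) / D ^+ 2 * expR (- (2 * ln n%:R))).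
    rewrite expRN expRM_natl lnK ?posrE//; field; rewrite !gt_eqF//.
  rewrite ler_wpM2l// expRN_div_le//; first by lra.
  by rewrite divr_gt0//= ler_pdivrMr// mul1r.
rewrite -mulr_suml -mulr_suml.
apply: (@le_trans _ _ (n%:R * (2 / n%:R ^+ 2))).
  apply: ler_wpM2r; first by rewrite divr_ge0 ?exprn_ge0 ?ltW.
  by rewrite ler_pdivrMr.
by apply: eqW; field; rewrite gt_eqF.
Qed.

End mean_theory.

End sign_patterns.

(** * Lower tail of a positive quadratic form *)

Section lower_tail.
Variable R : realType.

Definition ffun_cons m (b : bool) (s : {ffun 'I_m -> bool}) :
  {ffun 'I_m.+1 -> bool} := [ffun i => if unlift ord0 i is Some j then s j else b].

Lemma ffun_cons0 m b (s : {ffun 'I_m -> bool}) : ffun_cons b s ord0 = b.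
Proof. by rewrite ffunE unlift_none. Qed.

Lemma ffun_consS m b (s : {ffun 'I_m -> bool}) j :
  ffun_cons b s (lift ord0 j) = s j.
Proof. by rewrite ffunE liftK. Qed.

Lemma mean_ffun_cons m (F : {ffun 'I_m.+1 -> bool} -> R) :
  mean F = mean (fun s => (F (ffun_cons true s) + F (ffun_cons false s)) / 2).
Proof.
rewrite /mean -mulr_suml -mulrA -invfM -exprS !card_ord; congr (_ / _).
pose tl (f : {ffun 'I_m.+1 -> bool}) : {ffun 'I_m -> bool} :=
  [ffun j => f (lift ord0 j)].
rewrite (reindex (fun p : bool * {ffun 'I_m -> bool} => ffun_cons p.1 p.2))/=.
  rewrite -(pair_bigA _ (fun b s => F (ffun_cons b s)))/= big_bool/=.
  by rewrite -big_split.
exists (fun f : {ffun 'I_m.+1 -> bool} => (f ord0, tl f)) => [[b s] _|f _] /=.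
  rewrite ffun_cons0; congr (_, _); apply/ffunP => j.
  by rewrite ffunE ffun_consS.
apply/ffunP => i; rewrite ffunE; case: unliftP => [j ->|->//].
by rewrite ffunE.
Qed.

Definition qf m (A : 'I_m -> 'I_m -> R) (u : 'I_m -> R) : R :=
  \sum_i \sum_j A i j * (u i * u j).

(** The counterpart of [ffun_cons] for real vectors, at which the hypotheses on
    the form are tested. *)
Definition vec_cons m (c : R) (u : 'I_m -> R) (i : 'I_m.+1) : R :=
  if unlift ord0 i is Some j then u j else c.

Definition minor0 m (A : 'I_m.+1 -> 'I_m.+1 -> R) (i j : 'I_m) : R :=
  A (lift ord0 i) (lift ord0 j).

Definition row0 m (A : 'I_m.+1 -> 'I_m.+1 -> R) (u : 'I_m -> R) : R :=
  \sum_j A ord0 (lift ord0 j) * u j.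

Lemma vec_cons0 m c (u : 'I_m -> R) : vec_cons c u ord0 = c.
Proof. by rewrite /vec_cons unlift_none. Qed.

Lemma vec_consS m c (u : 'I_m -> R) j : vec_cons c u (lift ord0 j) = u j.
Proof. by rewrite /vec_cons liftK. Qed.

Lemma eq_qf m (A : 'I_m -> 'I_m -> R) u v : u =1 v -> qf A u = qf A v.
Proof.
by move=> uv; apply: eq_bigr => i _; apply: eq_bigr => j _; rewrite !uv.
Qed.

Lemma qf_vec_cons m (A : 'I_m.+1 -> 'I_m.+1 -> R) c u :
  (forall i j, A i j = A j i) ->
  qf A (vec_cons c u) =
    A ord0 ord0 * c ^+ 2 + 2 * c * row0 A u + qf (minor0 A) u.
Proof.
move=> symA; rewrite /qf big_ord_recl big_ord_recl vec_cons0.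
under eq_bigr do rewrite vec_consS.
under [X in _ + X]eq_bigr => i _.
  rewrite big_ord_recl vec_cons0 vec_consS symA.
  under eq_bigr do rewrite vec_consS.
  over.
rewrite big_split/= -!addrA expr2; congr (_ + _).
rewrite addrA; congr (_ + _).
rewrite /row0 mulr_sumr -big_split/=; apply: eq_bigr => j _.
by ring.
Qed.

Lemma sqnorm_vec_cons m c (u : 'I_m -> R) :
  sqnorm (vec_cons c u) = c ^+ 2 + sqnorm u.
Proof.
rewrite /sqnorm big_ord_recl vec_cons0; congr (_ + _).
by apply: eq_bigr => j _; rewrite vec_consS.
Qed.

Lemma row0_scale m (A : 'I_m.+1 -> 'I_m.+1 -> R) c u :
  row0 A (fun j => c * u j) = c * row0 A u.
Proof. by rewrite /row0 mulr_sumr; apply: eq_bigr => j _; ring. Qed.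

(** Averaging over one sign turns the linear term [B] of the quadratic form into
    [cosh B <= exp (B ^+ 2 / 2)], i.e. subtracts a rank-one matrix from the
    remaining form. The diagonal entry [a] at that coordinate is at most [1], so
    this subtracts no more than the Schur complement would, and positivity
    survives. With [b] the rest of the row, the trace drops by [a + |b| ^+ 2], at
    most [2 * a], while the factor [exp (- a / 2)] is gained. *)
Lemma mean_expRN_qf m (A : 'I_m -> 'I_m -> R) :
  (forall i j, A i j = A j i) ->
  (forall u, 0 <= qf A u) -> (forall u, qf A u <= sqnorm u) ->
  mean (fun s : {ffun 'I_m -> bool} => expR (- (qf A (fun i => sg R (s i)) / 2)))
    <= expR (- ((\sum_i A i i) / 4)).
Proof.
elim: m A => [|m IH] A symA A0 A1.
  rewrite (@eq_mean _ _ _ (fun=> 1)) ?mean_cst ?big_ord0 ?mul0r ?oppr0 ?expR0//.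
  by move=> s; rewrite /qf big_ord0 mul0r oppr0 expR0.
pose a := A ord0 ord0.
pose b (j : 'I_m) := A ord0 (lift ord0 j).
pose A2 i j := minor0 A i j - b i * b j.
have qfA2 u : qf A2 u = qf (minor0 A) u - row0 A u ^+ 2.
  rewrite /qf expr2 /row0 big_distrlr/= -sumrB; apply: eq_bigr => i _.
  rewrite -sumrB; apply: eq_bigr => j _.
  by rewrite /A2 /b; ring.
have qf0 (f : 'I_m -> R) : f =1 (fun=> 0) -> qf (minor0 A) f = 0.
  move=> f0; rewrite (eq_qf _ f0) /qf big1// => i _; rewrite big1// => j _.
  by rewrite mulr0 mulr0.
have row00 : row0 A (fun=> 0) = 0.
  by rewrite /row0 big1// => j _; rewrite mulr0.
have a1 : a <= 1.
  have := A1 (vec_cons 1 (fun=> 0)).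
  rewrite qf_vec_cons// sqnorm_vec_cons row00 qf0// /sqnorm big1.
    by rewrite /a; lra.
  by move=> i _; rewrite expr0n.
have minor_le u : qf (minor0 A) u <= sqnorm u.
  have := A1 (vec_cons 0 u).
  rewrite qf_vec_cons// sqnorm_vec_cons; lra.
(* positivity at the vector (1, -b), where the lower block contributes at
   most |b|^2 *)
have ba : sqnorm b <= a.
  have bb : row0 A (fun j => -1 * b j) = - sqnorm b.
    by rewrite row0_scale mulN1r.
  have := A0 (vec_cons 1 (fun j => -1 * b j)).
  rewrite qf_vec_cons// bb -/a.
  have := minor_le (fun j => -1 * b j).
  have -> : sqnorm (fun j => -1 * b j) = sqnorm b.
    by rewrite /sqnorm; apply: eq_bigr => j _; rewrite mulN1r sqrrN.
  lra.
(* positivity of [A] at (- B u, u) *)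
have A2pos u : 0 <= qf A2 u.
  rewrite qfA2.
  have := A0 (vec_cons (- row0 A u) u).
  rewrite qf_vec_cons// -/a; nra.
have A2le u : qf A2 u <= sqnorm u.
  by rewrite qfA2; apply: le_trans (minor_le u); rewrite gerBl sqr_ge0.
have A2sym i j : A2 i j = A2 j i by rewrite /A2 /minor0 symA [b i * _]mulrC.
rewrite mean_ffun_cons.
apply: (@le_trans _ _ (mean (fun s : {ffun 'I_m -> bool} =>
    expR (- (a / 2)) * expR (- (qf A2 (fun i => sg R (s i)) / 2))))).
  apply: le_mean => s; rewrite -expRD qfA2.
  set u := fun i => sg R (s i).
  have qfE c : qf A (fun i => sg R (ffun_cons c s i)) =
      a + 2 * sg R c * row0 A u + qf (minor0 A) u.
    rewrite (@eq_qf _ _ _ (vec_cons (sg R c) u)).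
      by rewrite qf_vec_cons// sg_sqr mulr1.
    by move=> i; rewrite /vec_cons ffunE; case: unliftP.
  rewrite !qfE /sg expr0 expr1.
  set B := row0 A u; set q := qf _ _.
  have -> : - ((a + 2 * -1 * B + q) / 2) = - ((a + q) / 2) + B by field.
  have -> : - ((a + 2 * 1 * B + q) / 2) = - ((a + q) / 2) - B by field.
  have -> : - (a / 2) - (q - B ^+ 2) / 2 = - ((a + q) / 2) + B ^+ 2 / 2 by field.
  rewrite !expRD -mulrDr -mulrA ler_wpM2l ?expR_ge0//.
  exact: cosh_le_expR.
rewrite meanZ; apply: (@le_trans _ _ (expR (- (a / 2)) *
    expR (- ((\sum_i A2 i i) / 4)))).
  by rewrite ler_wpM2l ?expR_ge0// IH.
rewrite -expRD ler_expR big_ord_recl -/a.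
have -> : \sum_i A2 i i = \sum_i A (lift ord0 i) (lift ord0 i) - sqnorm b.
  by rewrite /sqnorm -sumrB; apply: eq_bigr => i _; rewrite expr2.
lra.
Qed.

(** The lower tail of [|M t|^2] around its mean, the squared Frobenius norm, by
    the exponential Chebyshev inequality; [L] is any bound on the squared
    operator norm. *)
Lemma sqnorm_lower_tail n m (M : 'I_n -> 'I_m -> R) (L : R) : 0 < L ->
  (forall u : 'I_m -> R, \sum_i (\sum_j M i j * u j) ^+ 2 <= L * sqnorm u) ->
  mean (fun t => (\sum_i dot (M i) t ^+ 2 < (\sum_i sqnorm (M i)) / 4)%R%:R)
    <= expR (- ((\sum_i sqnorm (M i)) / L / 8)).
Proof.
move=> L0 ML; set F2 := \sum_i sqnorm (M i).
pose A j k := (\sum_i M i j * M i k) / L.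
have qfA u : qf A u = (\sum_i (\sum_j M i j * u j) ^+ 2) / L.
  rewrite /qf /A.
  under eq_bigr do under eq_bigr do rewrite mulrAC mulr_suml.
  under eq_bigr do rewrite -mulr_suml exchange_big/=.
  rewrite -mulr_suml exchange_big/=; congr (_ / _).
  apply: eq_bigr => i _; rewrite expr2 big_distrlr/=.
  by apply: eq_bigr => j _; apply: eq_bigr => k _; ring.
have trA : \sum_j A j j = F2 / L.
  rewrite -mulr_suml exchange_big/=; congr (_ / _).
apply: (@le_trans _ _ (mean (fun t : {ffun 'I_m -> bool} =>
    expR (F2 / L / 8) * expR (- (qf A (fun i => sg R (t i)) / 2))))).
  apply: le_mean => t; rewrite -expRD.
  rewrite (_ : qf A _ = (\sum_i dot (M i) t ^+ 2) / L); last exact: qfA.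
  set S := \sum_i dot (M i) t ^+ 2.
  case: ltP => [h|_]; last exact: expR_ge0.
  rewrite /= -[leLHS]expR0 ler_expR.
  have -> : F2 / L / 8 - S / L / 2 = (F2 / 4 - S) / (2 * L).
    by field; rewrite gt_eqF.
  by rewrite divr_ge0 ?mulr_ge0 ?subr_ge0 ?ltW.
rewrite meanZ.
apply: (@le_trans _ _ (expR (F2 / L / 8) * expR (- ((\sum_i A i i) / 4)))).
  rewrite ler_wpM2l ?expR_ge0// mean_expRN_qf//.
  - by move=> i j; rewrite /A; congr (_ / _); apply: eq_bigr => k _; ring.
  - by move=> u; rewrite qfA divr_ge0 ?(ltW L0)// sumr_ge0// => i _; exact: sqr_ge0.
  - by move=> u; rewrite qfA ler_pdivrMr// mulrC.
by rewrite -expRD ler_expR trA; lra.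
Qed.

End lower_tail.

(** * Small ball probability of a Rademacher sum *)

Section small_ball.
Variable R : realType.

Lemma dot_ffun_cons m (w : 'I_m.+1 -> R) b (s : {ffun 'I_m -> bool}) :
  dot w (ffun_cons b s) = w ord0 * sg R b + dot (fun j : 'I_m => w (lift ord0 j)) s.
Proof.
rewrite /dot big_ord_recl ffun_cons0; congr (_ + _).
by apply: eq_bigr => j _; rewrite ffun_consS.
Qed.

(** The characteristic function of a Rademacher sum, in real form. *)
Lemma mean_cos_dot m (w : 'I_m -> R) (x : R) :
  mean (fun s => cos (dot w s + x)) = cos x * \prod_i cos (w i).
Proof.
elim: m w x => [|m IH] w x.
  rewrite (@eq_mean _ _ _ (fun=> cos x)) ?mean_cst ?big_ord0 ?mulr1//.
  by move=> s; rewrite /dot big_ord0 add0r.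
rewrite mean_ffun_cons big_ord_recl mulrCA -(IH (fun j => w (lift ord0 j))) -meanZ.
apply: eq_mean => s.
rewrite !dot_ffun_cons /sg expr0 expr1 mulrN1 mulr1 -!addrA.
by rewrite ![cos (_ + (_ + _))]cosD cosN sinN; field.
Qed.

Lemma mean_cos_dot_le m (w : 'I_m -> R) (x : R) : (forall i, `|w i| <= 1) ->
  mean (fun s => cos (dot w s + x)) <= expR (- (sqnorm w / 4)).
Proof.
move=> w1; have cw i : 0 <= cos (w i) <= expR (- (w i ^+ 2 / 4)).
  rewrite cos_le_expR// andbT; have := cos_ge_quadratic (w i).
  have : w i ^+ 2 <= 1 by rewrite -real_normK ?num_real// expr_le1.
  lra.
rewrite mean_cos_dot; apply: (@le_trans _ _ (\prod_i cos (w i))).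
  by rewrite ler_piMl ?cos_le1// prodr_ge0// => i _; case/andP: (cw i).
rewrite /sqnorm mulr_suml -sumrN expR_sum.
by apply: ler_prod => i _; exact: cw.
Qed.

Lemma sum_geometric_le (rho : R) n : 0 <= rho < 1 ->
  \sum_(j < n) rho ^+ j <= (1 - rho)^-1.
Proof.
move=> /andP[rho0 rho1].
rewrite -[leRHS]mul1r ler_pdivlMr ?subr_gt0// mulrC -[1 - rho]opprB mulNr -subrX1.
by rewrite opprB gerBl exprn_ge0.
Qed.

(** Along a row of the Fejer double sum the Gaussian factors are dominated by two
    geometric series, so the row costs [O(1 / q)] whatever its length. *)
Lemma sum_expRN_dist_le (q : R) n (k : 'I_n) : 0 < q <= 1 ->
  \sum_(l < n) expR (- (q * `|k%:R - l%:R|)) <= 4 / q.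
Proof.
move=> /andP[q0 q1]; pose rho := expR (- q).
have rho0 : 0 <= rho by exact: expR_ge0.
have rhole : rho <= (1 + q)^-1.
  by rewrite /rho expRN lef_pV2 ?posrE ?expR_gt0 ?expR_ge1Dx ?addr_gt0.
have rho1 : rho < 1 by rewrite /rho expR_lt1 oppr_lt0.
have geo : (1 - rho)^-1 <= 2 / q.
  rewrite -[2 / q]invrK invf_div lef_pV2 ?posrE ?divr_gt0 ?subr_gt0//.
  apply: (@le_trans _ _ (1 - (1 + q)^-1)); last by rewrite lerD2l lerN2.
  have -> : 1 - (1 + q)^-1 = q / (1 + q) by field; rewrite gt_eqF// addr_gt0.
  by rewrite ler_pM2l// lef_pV2 ?posrE ?addr_gt0//; lra.
rewrite -(big_mkord xpredT (fun l => expR (- (q * `|k%:R - l%:R|)))).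
rewrite (big_cat_nat _ (n := k))//=; last exact: ltnW.
apply: (@le_trans _ _ (2 / q + 2 / q)); last by lra.
apply: lerD.
  rewrite big_nat_rev/= add0n big_mkord.
  apply: (@le_trans _ _ (\sum_(j < k) rho ^+ j)).
    apply: ler_sum => j _; rewrite -expRM_natl ler_expR.
    have jk : (j.+1 <= k)%N by [].
    rewrite -natrB ?leq_subr// subKn// normr_nat mulrN lerN2 mulrC.
    by rewrite ler_wpM2l ?(ltW q0)// ler_nat.
  by apply: le_trans geo; apply: sum_geometric_le; rewrite rho0 rho1.
rewrite -{1}[k : nat]add0n big_addn big_mkord.
apply: (@le_trans _ _ (\sum_(j < n - k) rho ^+ j)).
  apply: ler_sum => j _; rewrite -expRM_natl ler_expR natrD opprD addrA addrAC.
  by rewrite subrr sub0r normrN normr_nat mulrN mulrC.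
by apply: le_trans geo; apply: sum_geometric_le; rewrite rho0 rho1.
Qed.

Lemma expR1_le4 : expR 1 <= 4 :> R.
Proof.
have -> : 1 = 2%:R * (1 / 2) :> R by field.
rewrite expRM_natl; have h : expR (1 / 2) <= 2 :> R.
  rewrite -[expR _]invrK -expRN -[leRHS]invrK lef_pV2 ?posrE ?expR_gt0//.
  by have := expR_ge1Dx (- (1 / 2) : R); lra.
by have := expR_ge0 (1 / 2 : R); nra.
Qed.

(** Up to normalisation, the Fejer kernel of order [N]: a trigonometric polynomial
    that is nonnegative everywhere. Using finitely many frequencies turns the
    Fourier integral in Esseen's inequality into a finite sum. *)
Lemma fejer_kernelE (N : nat) (y : R) :
  \sum_(k < N) \sum_(l < N) cos ((k%:R - l%:R) * y) =
  (\sum_(k < N) cos (k%:R * y)) ^+ 2 + (\sum_(k < N) sin (k%:R * y)) ^+ 2.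
Proof.
rewrite !expr2 !big_distrlr/= -big_split/=; apply: eq_bigr => k _.
by rewrite -big_split/=; apply: eq_bigr => l _; rewrite mulrBl cosB.
Qed.

Lemma fejer_kernel_ge (N : nat) (y : R) : N%:R * `|y| <= 1 ->
  N%:R ^+ 2 / 4 <= \sum_(k < N) \sum_(l < N) cos ((k%:R - l%:R) * y).
Proof.
move=> Ny; rewrite fejer_kernelE.
apply: ler_wpDr; first exact: sqr_ge0.
have h : N%:R / 2 <= \sum_(k < N) cos (k%:R * y).
  have -> : N%:R / 2 = \sum_(k < N) (1 / 2 : R).
    by rewrite sumr_const card_ord -[RHS]mulr_natl mul1r.
  apply: ler_sum => k _; apply: le_trans (cos_ge_quadratic _).
  have : (k%:R * y) ^+ 2 <= 1.
    rewrite -real_normK ?num_real// expr_le1// normrM normr_nat.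
    by apply: le_trans Ny; rewrite ler_wpM2r// ler_nat ltnW.
  lra.
have N0 : 0 <= N%:R :> R by [].
nra.
Qed.

(** Esseen's argument: the indicator of the ball is dominated by a Fejer kernel
    whose frequencies stay below [1 / t]. There the characteristic function is
    Gaussian, because no [w i] exceeds [t]. *)
Theorem small_ball m (w : 'I_m -> R) (x t : R) : 0 < t ->
  (forall i, `|w i| <= t) -> 0 < sqnorm w ->
  mean (fun s => (`|dot w s - x| <= t)%R%:R) <= 64 * t / Num.sqrt (sqnorm w).
Proof.
move=> t0 wt w0; set sigma := Num.sqrt _.
have s0 : 0 < sigma by rewrite sqrtr_gt0.
have s2 : sigma ^+ 2 = sqnorm w by rewrite sqr_sqrtr// ltW.
(* [N] is large enough to resolve the scale [sigma] of the sum, and the mesh [h]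
   puts all [N] frequencies in [[0, 1 / t]]. *)
pose N := (Num.truncn (sigma / t)).+1.
have N0 : 0 < N%:R :> R by rewrite ltr0n.
have tN0 : 0 < t * N%:R by rewrite mulr_gt0.
have Ns : sigma / t <= N%:R by rewrite ltW// truncnS_gt.
pose h := (t * N%:R)^-1.
have h0 : 0 < h by rewrite invr_gt0.
pose q := h * sigma.
have q0 : 0 < q by rewrite mulr_gt0.
have q1 : q <= 1.
  by rewrite /q mulrC ler_pdivrMr// mul1r mulrC -ler_pdivrMr.
have cosle (k l : 'I_N) :
    mean (fun s => cos ((k%:R - l%:R) * (h * (dot w s - x))))
      <= 4 * expR (- (q * `|k%:R - l%:R|)).
  set e : R := k%:R - l%:R.
  have e1 : `|e| <= N%:R.
    have kN : k%:R <= N%:R :> R by rewrite ler_nat ltnW.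
    have lN : l%:R <= N%:R :> R by rewrite ler_nat ltnW.
    have [k0 l0] : 0 <= k%:R :> R /\ 0 <= l%:R :> R by [].
    by rewrite /e ler_norml; apply/andP; split; lra.
  rewrite (eq_mean (G := fun s => cos (dot (fun i => e * h * w i) s - e * h * x))).
    apply: (@le_trans _ _ (expR (- (sqnorm (fun i => e * h * w i) / 4)))).
      apply: mean_cos_dot_le => i.
      rewrite !normrM (gtr0_norm h0) -mulrA.
      apply: (@le_trans _ _ (N%:R * (h * t))); last first.
        by rewrite /h invfM; apply: eqW; field; rewrite !gt_eqF.
      by rewrite ler_pM ?mulr_ge0 ?(ltW h0)// ler_wpM2l// ltW.
    have -> : sqnorm (fun i => e * h * w i) = (q * `|e|) ^+ 2.
      rewrite /sqnorm; under eq_bigr do rewrite exprMn.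
      by rewrite -mulr_sumr -/(sqnorm w) -s2 /q !exprMn real_normK ?num_real//; ring.
    (* [(u / 2 - 1) ^+ 2 >= 0] trades the Gaussian for a geometric decay *)
    apply: (@le_trans _ _ (expR 1 * expR (- (q * `|e|)))).
      rewrite -expRD ler_expR; set u := q * _.
      by have := sqr_ge0 (u / 2 - 1); nra.
    by rewrite ler_wpM2r ?expR_ge0 ?expR1_le4.
  move=> s; congr cos; rewrite mulrA mulrBr; congr (_ - _).
  by rewrite /dot mulr_sumr; apply: eq_bigr => i _; rewrite mulrA.
apply: (@le_trans _ _ (mean (fun s => 4 / N%:R ^+ 2 *
    \sum_(k < N) \sum_(l < N) cos ((k%:R - l%:R) * (h * (dot w s - x)))))).
  apply: le_mean => s.
  have c0 : 0 <= 4 / N%:R ^+ 2 :> R by rewrite divr_ge0 ?exprn_ge0 ?ltW.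
  case: (leP `|dot w s - x| t) => [yt|_]; last first.
    by rewrite mulr_ge0// fejer_kernelE addr_ge0// sqr_ge0.
  apply: (@le_trans _ _ (4 / N%:R ^+ 2 * (N%:R ^+ 2 / 4))).
    by apply: eqW => /=; field; rewrite gt_eqF.
  rewrite ler_wpM2l// fejer_kernel_ge// normrM (gtr0_norm h0).
  have -> : N%:R * ((t * N%:R)^-1 * `|dot w s - x|) = `|dot w s - x| / t.
    by field; rewrite !gt_eqF.
  by rewrite ler_pdivrMr// mul1r.
rewrite meanZ mean_sum.
apply: (@le_trans _ _ (4 / N%:R ^+ 2 * \sum_(k < N) (16 / q))).
  rewrite ler_wpM2l ?divr_ge0 ?exprn_ge0 ?(ltW N0)//; apply: ler_sum => k _.
  rewrite mean_sum; apply: (@le_trans _ _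
    (4 * \sum_(l < N) expR (- (q * `|k%:R - l%:R|)))).
    by rewrite mulr_sumr; apply: ler_sum => l _; exact: cosle.
  have -> : 16 / q = 4 * (4 / q) by field; rewrite gt_eqF.
  by rewrite ler_wpM2l// sum_expRN_dist_le// q0 q1.
rewrite sumr_const card_ord -(mulr_natl (16 / q) N) /q /h; apply: eqW.
by field; rewrite !gt_eqF.
Qed.

End small_ball.

(** * Flips and matrix norms *)

Section matrix_bounds.
Variable R : realType.
Variables n m : nat.
Implicit Types (M : 'M[R]_(n, m)).

Definition sign_bilin M (s : {ffun 'I_n -> bool}) (t : {ffun 'I_m -> bool}) : R :=
  dot (fun i => dot (M i) t) s.

Definition flips (I : finType) (s s' : {ffun I -> bool}) : nat :=
  #|[pred i | s i != s' i]|.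

Lemma sqnorm_ge0 (I : finType) (w : I -> R) : 0 <= sqnorm w.
Proof. by apply: sumr_ge0 => i _; exact: sqr_ge0. Qed.

Lemma cauchy_schwarz_sum (I : finType) (w u : I -> R) :
  (\sum_i w i * u i) ^+ 2 <= sqnorm w * sqnorm u.
Proof.
have : 0 <= \sum_i \sum_j (w i * u j - w j * u i) ^+ 2.
  by apply: sumr_ge0 => i _; apply: sumr_ge0 => j _; exact: sqr_ge0.
have -> : \sum_i \sum_j (w i * u j - w j * u i) ^+ 2 =
    sqnorm w * sqnorm u + sqnorm u * sqnorm w
    - 2 * ((\sum_i w i * u i) * (\sum_i w i * u i)).
  rewrite /sqnorm !big_distrlr/= mulr_sumr -big_split -sumrB/=.
  apply: eq_bigr => i _; rewrite mulr_sumr -big_split -sumrB/=.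
  by apply: eq_bigr => j _; ring.
by rewrite expr2; lra.
Qed.

Lemma max_entry_ge M i j : `|M i j| <= max_entry M.
Proof.
rewrite /max_entry; apply: le_trans (le_bigmax _ _ i).
exact: (le_bigmax _ (fun j => `|M i j|) j).
Qed.

Lemma max_entry_ge0 M : 0 <= max_entry M.
Proof. by rewrite /max_entry bigmax_idl le_max lexx. Qed.

Lemma row_supp_le M i : (#|[pred j | M i j != 0%R]| <= maxsupp M)%N.
Proof.
rewrite leq_max; apply/orP; left.
exact: (leq_bigmax_cond (F := fun i => #|[pred j | M i j != 0%R]|)).
Qed.

Lemma col_supp_le M j : (#|[pred i | M i j != 0%R]| <= maxsupp M)%N.
Proof.
rewrite leq_max; apply/orP; right.
apply: leq_trans (leq_bigmax_cond (F := fun j => #|[pred i | M^T j i != 0%R]|) j _) => //.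
by apply: eq_leq; apply: eq_card => i; rewrite !inE mxE.
Qed.

Lemma frobenius_sqr p q (A : 'M[R]_(p, q)) : frobenius A ^+ 2 = \sum_i sqnorm (A i).
Proof.
rewrite sqr_sqrtr//; apply: sumr_ge0 => i _; exact: sqnorm_ge0.
Qed.

Lemma frobenius_ge0 p q (A : 'M[R]_(p, q)) : 0 <= frobenius A.
Proof. exact: sqrtr_ge0. Qed.

Lemma frobenius_sqr_tr M : frobenius M ^+ 2 = \sum_j sqnorm (M^T j).
Proof.
rewrite frobenius_sqr exchange_big; apply: eq_bigr => j _.
by apply: eq_bigr => i _; rewrite mxE.
Qed.

Lemma frobenius_gt0 M : M != 0 -> 0 < frobenius M.
Proof.
move=> M0; rewrite lt_def frobenius_ge0 andbT; apply: contra M0 => /eqP F0.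
have := frobenius_sqr M; rewrite F0 expr0n/= => /esym/eqP.
rewrite psumr_eq0 => [/allP h|i _]; last exact: sqnorm_ge0.
apply/eqP/matrixP => i j; rewrite mxE.
have := h i (mem_index_enum _); rewrite /= psumr_eq0 => [/allP hi|k _].
  by have := hi j (mem_index_enum _); rewrite /= sqrf_eq0 => /eqP.
exact: sqr_ge0.
Qed.

Lemma max_row_norm_ge0 p q (A : 'M[R]_(p, q)) : 0 <= max_row_norm A.
Proof.
by rewrite /max_row_norm bigmax_idl le_max lexx.
Qed.

Lemma row_norm_le p q (A : 'M[R]_(p, q)) i : sqnorm (A i) <= max_row_norm A ^+ 2.
Proof.
have -> : sqnorm (A i) = frobenius (row i A) ^+ 2.
  by rewrite frobenius_sqr big_ord1; apply: eq_bigr => j _; rewrite mxE.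
rewrite ler_pXn2r// ?nnegrE ?frobenius_ge0 ?max_row_norm_ge0//.
exact: (le_bigmax _ (fun i => frobenius (row i A))).
Qed.

Lemma maxdiam_ge0 M : 0 <= maxdiam M.
Proof. by rewrite le_max max_row_norm_ge0. Qed.

Lemma sqnorm_row_le M i : sqnorm (M i) <= maxdiam M ^+ 2.
Proof.
apply: le_trans (row_norm_le M i) _.
by rewrite ler_pXn2r// ?nnegrE ?max_row_norm_ge0 ?maxdiam_ge0// le_max lexx.
Qed.

Lemma sqnorm_col_le M j : sqnorm (M^T j) <= maxdiam M ^+ 2.
Proof.
apply: le_trans (row_norm_le M^T j) _.
by rewrite ler_pXn2r// ?nnegrE ?max_row_norm_ge0 ?maxdiam_ge0// le_max lexx orbT.
Qed.

Lemma frobenius_sqr_le_maxdiam M : frobenius M ^+ 2 <= n%:R * maxdiam M ^+ 2.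
Proof.
rewrite frobenius_sqr; apply: (@le_trans _ _ (\sum_(i < n) maxdiam M ^+ 2)).
  by apply: ler_sum => i _; exact: sqnorm_row_le.
by rewrite sumr_const card_ord mulr_natl.
Qed.

(** The set [A] of flipped indices and the support of [w] both limit the number
    of terms; [minn r (maxsupp M)] comes from having the choice. *)
Lemma norm_sum_supp_le (I : finType) (w e : I -> R) (A : pred I) (B c : R) (k : nat) :
  0 <= B -> 0 <= c -> (forall i, `|w i| <= B) ->
  (forall i, `|e i| <= c * (A i)%:R) ->
  (#|[pred i | A i && (w i != 0%R)]| <= k)%N ->
  `|\sum_i w i * e i| <= k%:R * (c * B).
Proof.
move=> B0 c0 wB eA supk; apply: le_trans (ler_norm_sum _ _ _) _.
apply: (@le_trans _ _ (\sum_(i | A i && (w i != 0)) c * B)).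
  rewrite [leRHS]big_mkcond/=; apply: ler_sum => i _; rewrite normrM.
  have [Ai|nAi] := boolP (A i) => /=; last first.
    have := eA i; rewrite (negbTE nAi) mulr0 normr_le0 => /eqP->.
    by rewrite normr0 mulr0.
  have [->|w0] := eqVneq; first by rewrite normr0 mul0r.
  by rewrite mulrC ler_pM//; have := eA i; rewrite Ai mulr1.
rewrite sumr_const -[leLHS]mulr_natl ler_wpM2r ?mulr_ge0// ler_nat.
exact: leq_trans supk.
Qed.

Lemma sg_diff_le (I : finType) (s s' : {ffun I -> bool}) i :
  `|sg R (s' i) - sg R (s i)| <= 2 * (s i != s' i)%:R.
Proof.
rewrite /sg; case: (s i); case: (s' i);
  by rewrite /= ?expr0 ?expr1 ?subrr ?normr0 ?mulr0// ler_norml; lra.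
Qed.

Lemma dot_le_supp M i t : `|dot (M i) t| <= (maxsupp M)%:R * max_entry M.
Proof.
rewrite -[max_entry M]mul1r; apply: (norm_sum_supp_le (A := predT)) => //.
- exact: max_entry_ge0.
- exact: max_entry_ge.
- by move=> j; rewrite norm_sg mulr1.
- exact: row_supp_le.
Qed.

Lemma dot_col_le_supp M j s : `|dot (M^T j) s| <= (maxsupp M)%:R * max_entry M.
Proof.
rewrite -[max_entry M]mul1r; apply: (norm_sum_supp_le (A := predT)) => //.
- exact: max_entry_ge0.
- by move=> i; rewrite mxE; exact: max_entry_ge.
- by move=> i; rewrite norm_sg mulr1.
- apply: leq_trans (col_supp_le M j).
  by apply: eq_leq; apply: eq_card => i; rewrite !inE mxE.
Qed.

Lemma dot_flip_le (I : finType) (w : I -> R) (B : R) (s s' : {ffun I -> bool}) :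
  0 <= B -> (forall i, `|w i| <= B) ->
  `|dot w s' - dot w s| <= (flips s s')%:R * (2 * B).
Proof.
move=> B0 wB; rewrite /dot -sumrB; under eq_bigr do rewrite -mulrBr.
apply: (norm_sum_supp_le (A := fun i => s i != s' i)) => //.
  exact: sg_diff_le.
by apply: subset_leq_card; apply/fintype.subsetP => i; rewrite !inE => /andP[].
Qed.

(** Expanding [(s + d)^T M (t + e)], the flips [d] and [e] act separately through
    [M t] and [M^T s], and jointly through the few entries of [M] that lie in a
    flipped row and a flipped column. *)
Lemma sign_bilin_flip_le M s t s' t' (K : R) (r : nat) :
  (flips s s' + flips t t' <= r)%N ->
  (forall i, `|dot (M i) t| <= K) -> (forall j, `|dot (M^T j) s| <= K) -> 0 <= K ->
  `|sign_bilin M s' t' - sign_bilin M s t| <=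
    r%:R * (2 * K + 4 * ((minn r (maxsupp M))%:R * max_entry M)).
Proof.
move=> hr rowK colK K0.
set G := _ * max_entry M.
have G0 : 0 <= G by rewrite mulr_ge0 ?max_entry_ge0.
have sign_bilinT u v : sign_bilin M u v = dot (fun j => dot (M^T j) u) v.
  rewrite /sign_bilin /dot; under eq_bigr do rewrite mulr_suml.
  rewrite exchange_big/=; apply: eq_bigr => j _.
  by rewrite mulr_suml; apply: eq_bigr => i _; rewrite mxE; ring.
have -> : sign_bilin M s' t' - sign_bilin M s t =
    (sign_bilin M s' t - sign_bilin M s t) +
    (sign_bilin M s t' - sign_bilin M s t) +
    \sum_i (dot (M i) t' - dot (M i) t) * (sg R (s' i) - sg R (s i)).
  rewrite /sign_bilin /dot -!sumrB -!big_split/=; apply: eq_bigr => i _.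
  by ring.
have h1 : `|sign_bilin M s' t - sign_bilin M s t| <= (flips s s')%:R * (2 * K).
  exact: dot_flip_le.
have h2 : `|sign_bilin M s t' - sign_bilin M s t| <= (flips t t')%:R * (2 * K).
  by rewrite !sign_bilinT; exact: dot_flip_le.
have h3 : `|\sum_i (dot (M i) t' - dot (M i) t) * (sg R (s' i) - sg R (s i))| <=
    (flips s s')%:R * (2 * (2 * G)).
  apply: (norm_sum_supp_le (A := fun i => s i != s' i)) => //.
  - by rewrite mulr_ge0.
  - move=> i; rewrite /dot -sumrB; under eq_bigr do rewrite -mulrBr.
    rewrite /G mulrCA; apply: (norm_sum_supp_le (A := fun i => t i != t' i)) => //.
    + exact: max_entry_ge0.
    + exact: max_entry_ge.
    + exact: sg_diff_le.
    + rewrite leq_min; apply/andP; split.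
        apply: leq_trans (leq_trans (leq_addl (flips s s') _) hr).
        by apply: subset_leq_card; apply/fintype.subsetP => j; rewrite !inE => /andP[].
      apply: leq_trans (row_supp_le M i).
      by apply: subset_leq_card; apply/fintype.subsetP => j; rewrite !inE => /andP[].
  - exact: sg_diff_le.
  - by apply: subset_leq_card; apply/fintype.subsetP => j; rewrite !inE => /andP[].
apply: le_trans (ler_normD _ _) _.
apply: le_trans (lerD (ler_normD _ _) (lexx _)) _.
apply: le_trans (lerD (lerD h1 h2) h3) _.
have hr' : (flips s s')%:R + (flips t t')%:R <= r%:R :> R by rewrite -natrD ler_nat.
have a0 : 0 <= (flips s s')%:R :> R by [].
have b0 : 0 <= (flips t t')%:R :> R by [].
nra.
Qed.

Lemma spectral_norm_bound M (u : 'I_m -> R) : (0 < m)%N ->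
  \sum_i (\sum_j M i j * u j) ^+ 2 <= spectral_norm M ^+ 2 * sqnorm u.
Proof.
move=> m0.
have colE (v : 'cV[R]_m) : frobenius v ^+ 2 = sqnorm (fun j => v j 0).
  by rewrite frobenius_sqr; apply: eq_bigr => j _; rewrite /sqnorm big_ord1.
have mulE (v : 'cV[R]_m) :
    frobenius (M *m v) ^+ 2 = \sum_i (\sum_j M i j * v j 0) ^+ 2.
  by rewrite frobenius_sqr; apply: eq_bigr => i _; rewrite /sqnorm big_ord1 mxE.
have sup_ub (v : 'cV[R]_m) : frobenius v = 1 -> frobenius (M *m v) <= spectral_norm M.
  move=> v1; apply: ub_le_sup; last by exists v.
  exists (frobenius M) => _ [w /= w1 <-].
  rewrite -(@ler_pXn2r _ 2)// ?nnegrE ?frobenius_ge0// mulE frobenius_sqr.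
  apply: ler_sum => i _; apply: le_trans (cauchy_schwarz_sum _ _) _.
  by rewrite -colE w1 expr1n mulr1.
have [u0|un0] := eqVneq (sqnorm u) 0.
  rewrite u0 mulr0 big1// => i _; apply/eqP.
  rewrite eq_le sqr_ge0 andbT; apply: le_trans (cauchy_schwarz_sum _ _) _.
  by rewrite u0 mulr0.
have ugt0 : 0 < sqnorm u by rewrite lt_def un0 sqnorm_ge0.
pose c := Num.sqrt (sqnorm u).
have c0 : 0 < c by rewrite sqrtr_gt0.
have c2 : c ^+ 2 = sqnorm u by rewrite sqr_sqrtr// ltW.
pose v : 'cV[R]_m := \col_j (u j / c).
have v1 : frobenius v = 1.
  apply/eqP; rewrite -(@eqrXn2 _ 2)// ?frobenius_ge0// colE expr1n.
  rewrite /sqnorm; under eq_bigr do rewrite mxE exprMn.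
  by rewrite -mulr_suml exprVn c2 divff.
have := sup_ub v v1.
rewrite -(@ler_pXn2r _ 2)// ?nnegrE ?frobenius_ge0//; last first.
  exact: le_trans (frobenius_ge0 _) (sup_ub v v1).
rewrite mulE -c2.
have -> : \sum_i (\sum_j M i j * v j 0) ^+ 2 = (\sum_i (\sum_j M i j * u j) ^+ 2) / c ^+ 2.
  rewrite mulr_suml; apply: eq_bigr => i _; rewrite -exprVn -exprMn mulr_suml.
  by congr (_ ^+ 2); apply: eq_bigr => j _; rewrite mxE mulrA.
by rewrite ler_pdivrMr// exprn_gt0.
Qed.

Lemma spectral_norm_sqr_gt0 M : (0 < m)%N -> M != 0 -> 0 < spectral_norm M ^+ 2.
Proof.
move=> m0 M0; rewrite lt_def sqr_ge0 andbT; apply: contra M0 => /eqP L0.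
apply/eqP/matrixP => i j; rewrite mxE.
have := spectral_norm_bound M (fun k => (k == j)%:R) m0.
rewrite L0 mul0r (bigD1 i)//= => h.
have h0 : (\sum_k M i k * (k == j)%:R) ^+ 2 <= 0.
  by apply: le_trans h; rewrite lerDl sumr_ge0// => k _; exact: sqr_ge0.
have : (\sum_k M i k * (k == j)%:R) ^+ 2 == 0 by rewrite eq_le h0 sqr_ge0.
rewrite sqrf_eq0 (bigD1 j)//= eqxx mulr1 big1 ?addr0; first by move/eqP.
by move=> k /negbTE->; rewrite mulr0.
Qed.

End matrix_bounds.

(** * Counting the sign patterns of small resilience *)

Section counting.
Variable R : realType.
Variables n m : nat.
Variable M : 'M[R]_(n, m).
Hypotheses (m_gt0 : (0 < m)%N) (M_neq0 : M != 0).

Definition reachable (x : R) (r : nat) (s : {ffun 'I_n -> bool})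
    (t : {ffun 'I_m -> bool}) : bool :=
  [exists s', [exists t', (sign_bilin M s' t' == x) && (flips s s' + flips t t' <= r)%N]].

Lemma max_entry_gt0 : 0 < max_entry M.
Proof.
rewrite lt_def max_entry_ge0 andbT; apply: contra M_neq0 => /eqP e0.
apply/eqP/matrixP => i j; rewrite mxE; apply/eqP.
by rewrite -normr_le0 -e0 max_entry_ge.
Qed.

Lemma maxsupp_gt0 : (0 < maxsupp M)%N.
Proof.
rewrite lt0n; apply: contra M_neq0 => /eqP s0; apply/eqP/matrixP => i j.
rewrite mxE; apply/eqP; apply: contraT => Mij.
have := row_supp_le M i; rewrite s0 leqn0 => /eqP/card0_eq/(_ j).
by rewrite !inE Mij.
Qed.

Lemma indicator_le (b : bool) (y : R) : 0 <= y -> (b -> 1 <= y) -> b%:R <= y.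
Proof. by move=> y0 h; case: b h => // h; exact: h. Qed.

(** Conditionally on [t], the bilinear form is a Rademacher sum with
    coefficient vector [M t], whose length is at least half its typical
    value [frobenius M] outside the lower tail event. *)
Lemma bilinear_small_ball (K T x : R) : K <= T -> 0 < T ->
  mean (fun t => mean (fun s =>
    ([forall i, `|dot (M i) t| <= K] && (`|sign_bilin M s t - x| <= T))%:R))
  <= expR (- (1 / 8) * stable_rank M) + 128 * T / frobenius M.
Proof.
move=> KT T0.
have F0 := frobenius_gt0 M_neq0.
have L0 := spectral_norm_sqr_gt0 m_gt0 M_neq0.
have := sqnorm_lower_tail L0 (fun u => spectral_norm_bound M u m_gt0).
rewrite -frobenius_sqr -/(stable_rank M).
rewrite (_ : - (stable_rank M / 8) = - (1 / 8) * stable_rank M); last by field.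
move=> tail.
apply: (@le_trans _ _ (mean (fun t =>
    (\sum_i dot (M i) t ^+ 2 < frobenius M ^+ 2 / 4)%R%:R
    + 128 * T / frobenius M))); last by rewrite meanD mean_cst lerD2r.
apply: le_mean => t.
have B0 : 0 <= 128 * T / frobenius M by rewrite divr_ge0 ?mulr_ge0 // ltW.
case: ltP => [_|big].
  rewrite ler_wpDr//= -[leRHS](@mean_cst _ 'I_n).
  by apply: le_mean => s; rewrite lern1 leq_b1.
rewrite add0r.
have [/forallP rowK|_] := boolP [forall i, `|dot (M i) t| <= K]; last first.
  by rewrite /= mean_cst.
rewrite -/(sqnorm (fun i => dot (M i) t)) in big.
have w0 : 0 < sqnorm (fun i => dot (M i) t).
  by apply: lt_le_trans big; rewrite divr_gt0 ?exprn_gt0.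
apply: le_trans (small_ball x T0 (fun i => le_trans (rowK i) KT) w0) _.
have half : frobenius M / 2 <= Num.sqrt (sqnorm (fun i => dot (M i) t)).
  rewrite -(@ler_pXn2r _ 2)// ?nnegrE ?sqrtr_ge0 ?divr_ge0 ?(ltW F0)//.
  rewrite sqr_sqrtr ?(ltW w0)//; apply: le_trans big.
  by apply: eqW; field.
rewrite ler_pdivrMr ?sqrtr_gt0//.
apply: (@le_trans _ _ (128 * T / frobenius M * (frobenius M / 2))).
  by apply: eqW; field; rewrite gt_eqF.
by rewrite ler_wpM2l.
Qed.

(** Unless a coordinate of [M t] or [M^T s] exceeds [K], resilience at most [r]
    forces [s^T M t] to within [T = r (4 K + 4 min(r, maxsupp) B)] of [x], with
    [B] the largest entry. This [T] is at least [K], hence at least every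
    coefficient of the Rademacher sum, and [128 * 4 = 512]. *)
Lemma mean_reachable_le (K p1 p2 x : R) (r : nat) : (0 < r)%N -> 0 <= K ->
  mean (fun t => [exists i, K < `|dot (M i) t|]%:R) <= p1 ->
  mean (fun s => [exists j, K < `|dot (M^T j) s|]%:R) <= p2 ->
  mean (fun t => mean (fun s => (reachable x r s t)%:R)) <=
    p1 + p2 + 512 * r%:R * (K / frobenius M + g_param M r)
    + expR (- (1 / 8) * stable_rank M).
Proof.
move=> r0 K0 p1P p2P.
have F0 := frobenius_gt0 M_neq0.
pose G := (minn r (maxsupp M))%:R * max_entry M.
have G0 : 0 < G.
  by rewrite mulr_gt0 ?max_entry_gt0// ltr0n leq_min r0 maxsupp_gt0.
pose T := r%:R * (4 * K + 4 * G).
have r1 : 1 <= r%:R :> R by rewrite ler1n.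
have KT : K <= T by rewrite /T; nra.
have T0 : 0 < T by rewrite /T mulr_gt0 ?ltr0n//; lra.
have := bilinear_small_ball x KT T0.
set sb := mean _ => sbP.
apply: (@le_trans _ _ (p1 + p2 + sb)); last first.
  apply: le_trans (lerD (lexx _) sbP) _; apply: eqW.
  by rewrite /g_param -/G /T; field; rewrite gt_eqF.
apply: (@le_trans _ _ (mean (fun t => [exists i, K < `|dot (M i) t|]%:R) +
    mean (fun s => [exists j, K < `|dot (M^T j) s|]%:R) + sb)); last first.
  by rewrite lerD2r lerD.
rewrite -[X in _ + X + _](@mean_cst _ 'I_m) -!meanD.
apply: le_mean => t; rewrite -[X in X + _ + _](@mean_cst _ 'I_n) -!meanD.
apply: le_mean => s; apply: indicator_le; first by rewrite !addr_ge0.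
move=> /existsP[s' /existsP[t' /andP[/eqP xE hr]]].
have [_|/existsPn nrow] := boolP [exists i, K < `|dot (M i) t|].
  by rewrite -addrA lerDl addr_ge0.
have [_|/existsPn ncol] := boolP [exists j, K < `|dot (M^T j) s|].
  by rewrite addrAC lerDr addr_ge0.
rewrite !add0r.
have rowK i : `|dot (M i) t| <= K by rewrite leNgt nrow.
have colK j : `|dot (M^T j) s| <= K by rewrite leNgt ncol.
have -> : [forall i, `|dot (M i) t| <= K] by apply/forallP.
rewrite distrC -xE (le_trans (sign_bilin_flip_le hr rowK colK K0))//.
by rewrite /T -/G ler_wpM2l//; lra.
Qed.

(** For a single row [f_param] vanishes because [ln 1 = 0], so a flip of the row
    sign cannot be charged to it. Such a flip only replaces [x] by [- x], whence
    two small balls for the sum over the columns, of radius [2 * max_entry M]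
    since one sign may flip there. *)
Lemma mean_reachable_one_row (x : R) : n = 1%N ->
  mean (fun t => mean (fun s => (reachable x 1 s t)%:R)) <= 256 * g_param M 1.
Proof.
move=> n1; have n0 : (0 < n)%N by rewrite n1.
pose i0 := Ordinal n0.
have only i : i = i0 by apply/val_inj => /=; case: i => i /=; rewrite n1; case: i.
have F0 := frobenius_gt0 M_neq0.
have sumE (F : 'I_n -> R) : \sum_i F i = F i0.
  by rewrite (bigD1 i0)//= big1 ?addr0// => i; rewrite (only i) eqxx.
have w0 : sqnorm (M i0) = frobenius M ^+ 2 by rewrite frobenius_sqr sumE.
have E0 := max_entry_gt0.
have sb y := @small_ball R m (M i0) y (2 * max_entry M).
have -> : 256 * g_param M 1 = 128 * max_entry M / frobenius M +
    128 * max_entry M / frobenius M.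
  rewrite /g_param (minn_idPl maxsupp_gt0) mul1r; by field; rewrite gt_eqF.
have sb' y : mean (fun t => (`|dot (M i0) t - y| <= 2 * max_entry M)%R%:R) <=
    128 * max_entry M / frobenius M.
  have := sb y; rewrite w0 sqrtr_sqr gtr0_norm// mulrA.
  rewrite -[64 * 2]natrM; apply => [|j|].
  - by rewrite mulr_gt0.
  - by apply: le_trans (max_entry_ge M i0 j) _; lra.
  - by rewrite exprn_gt0.
apply: le_trans (lerD (sb' x) (sb' (- x))).
rewrite -meanD; apply: le_mean => t.
rewrite -[leRHS](@mean_cst _ 'I_n); apply: le_mean => s.
apply: indicator_le; first by rewrite addr_ge0.
move=> /existsP[s' /existsP[t' /andP[/eqP xE hr]]].
have tt' : `|dot (M i0) t' - dot (M i0) t| <= 2 * max_entry M.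
  apply: le_trans (dot_flip_le t t' (max_entry_ge0 M) (max_entry_ge M i0)) _.
  rewrite -[leRHS]mul1r ler_wpM2r ?mulr_ge0 ?max_entry_ge0//.
  by rewrite lern1 (leq_trans _ hr)// leq_addl.
rewrite distrC in tt'.
move: xE; rewrite /sign_bilin {1}/dot sumE /sg; case: (s' i0); rewrite ?expr1 ?expr0.
  by rewrite mulrN1 => <-; rewrite opprK tt' lerDr.
by rewrite mulr1 => <-; rewrite tt' lerDl.
Qed.

Theorem mean_reachable (x : R) (r : nat) : (1 <= r <= n)%N ->
  mean (fun t => mean (fun s => (reachable x r s t)%:R)) <=
    1032 * r%:R * f_param M n + 512 * r%:R * g_param M r
    + expR (- (1 / 8) * stable_rank M).
Proof.
move=> /andP[r0 rn].
have F0 := frobenius_gt0 M_neq0.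
have r1 : 1 <= r%:R :> R by rewrite ler1n.
have S0 : 0 <= expR (- (1 / 8) * stable_rank M) by exact: expR_ge0.
have D0 := maxdiam_ge0 M.
have E0 := max_entry_ge0 M.
have f0 : 0 <= f_param M n.
  by rewrite divr_ge0 ?(ltW F0)// le_min !mulr_ge0 ?sqrtr_ge0.
have g0 : 0 <= g_param M r by rewrite divr_ge0 ?(ltW F0)// mulr_ge0.
have [n1|n1] := leqP n 1.
  have nE : n = 1%N by apply/eqP; rewrite eqn_leq n1 (leq_trans r0 rn).
  have rE : r = 1%N by apply/eqP; rewrite eqn_leq r0 (leq_trans rn n1).
  have := mean_reachable_one_row x nE.
  move: g0; rewrite rE => g0 h; apply: le_trans h _.
  nra.
rewrite /f_param minElt; case: ifP => _.
  pose K := (maxsupp M)%:R * max_entry M.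
  have K0 : 0 <= K by rewrite mulr_ge0.
  have z1 : mean (fun t => [exists i, K < `|dot (M i) t|]%:R) <= 0 :> R.
    rewrite -[leRHS](@mean_cst _ 'I_m); apply: le_mean => t.
    by case: existsP => // -[i]; rewrite ltNge dot_le_supp.
  have z2 : mean (fun s => [exists j, K < `|dot (M^T j) s|]%:R) <= 0 :> R.
    rewrite -[leRHS](@mean_cst _ 'I_n); apply: le_mean => s.
    by case: existsP => // -[j]; rewrite ltNge dot_col_le_supp.
  apply: le_trans (mean_reachable_le x r0 K0 z1 z2) _.
  rewrite lerD2r -/K.
  have : 0 <= r%:R * (K / frobenius M) by rewrite mulr_ge0// divr_ge0// ltW.
  by set q := K / frobenius M; nra.
have Dgt0 : 0 < maxdiam M.
  rewrite lt_def D0 andbT; apply/eqP => D00.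
  have := frobenius_sqr_le_maxdiam M; rewrite D00 expr0n/= mulr0.
  by rewrite leNgt exprn_gt0.
have frow : \sum_i sqnorm (M i) <= n%:R * maxdiam M ^+ 2.
  by rewrite -frobenius_sqr frobenius_sqr_le_maxdiam.
have fcol : \sum_j sqnorm (M^T j) <= n%:R * maxdiam M ^+ 2.
  by rewrite -frobenius_sqr_tr frobenius_sqr_le_maxdiam.
have p1 := hoeffding_family n1 Dgt0 (sqnorm_row_le M) frow.
have p2 := hoeffding_family n1 Dgt0 (sqnorm_col_le M) fcol.
set l := Num.sqrt (ln n%:R) in p1 p2 *.
have l0 : 0 <= l by rewrite sqrtr_ge0.
have K0 : 0 <= 2 * l * maxdiam M by rewrite !mulr_ge0.
apply: le_trans (mean_reachable_le x r0 K0 p1 p2) _.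
rewrite lerD2r.
have n0 : 0 < n%:R :> R by rewrite ltr0n (ltn_trans _ n1).
(* [frobenius M <= sqrt n * maxdiam M], so the failure probability [1 / n] is
   dominated by [f] *)
have nf : n%:R^-1 <= 2 * (l * maxdiam M / frobenius M).
  have lhalf : 1 / 2 <= l.
    rewrite -(@ler_pXn2r _ 2)// ?nnegrE// sqr_sqrtr ?ln_ge0 ?ler1n ?(ltnW n1)//.
    by apply: le_trans (ln_nat_ge_half R n1); lra.
  have Fn : frobenius M <= n%:R * maxdiam M.
    rewrite -(@ler_pXn2r _ 2)// ?nnegrE ?mulr_ge0 ?frobenius_ge0//.
    apply: le_trans (frobenius_sqr_le_maxdiam M) _.
    rewrite exprMn ler_wpM2r ?sqr_ge0// expr2 ler_peMl// ?ler1n ?(ltnW n1)//.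
  rewrite mulrA ler_pdivlMr// mulrC ler_pdivrMr//.
  apply: le_trans Fn _.
  have : 0 <= n%:R * maxdiam M by rewrite mulr_ge0.
  nra.
have q0 : 0 <= l * maxdiam M / frobenius M.
  by rewrite divr_ge0 ?mulr_ge0 // ltW.
set q := l * maxdiam M / frobenius M in nf q0 *.
have -> : 2 * l * maxdiam M / frobenius M = 2 * q by rewrite /q; ring.
set nv := n%:R^-1 in nf *.
have rq : q <= r%:R * q by rewrite ler_peMl.
nra.
Qed.

End counting.

(** * From random vectors to sign patterns *)

Section transfer.
Variable R : realType.

(** An event is at most as likely as the fraction of equally likely atoms that
    it meets; passing to the complement disposes of the null set outside the
    atoms. *)
Lemma probability_le_atoms d (T : measurableType d) (P : probability T R)
    (K : finType) (A : K -> set T) (Q : pred K) (E : set T) (p : R) :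
  measurable E -> (forall k, measurable (A k)) -> trivIset setT A ->
  (forall k, P (A k) = p%:E) -> #|K|%:R * p = 1 ->
  (forall k, A k `&` E !=set0 -> Q k) ->
  (P E <= (\sum_(k | Q k) p)%:E)%E.
Proof.
move=> mE mA tA PA Kp AQ.
pose D := [seq k <- enum K | ~~ Q k].
have uD : uniq D by rewrite filter_uniq// enum_uniq.
have PD : P (\bigcup_(k in [set` D]) A k) = (\sum_(k | ~~ Q k) p)%:E.
  rewrite measure_fin_bigcup//; last exact: sub_trivIset tA.
  rewrite -fsbig_seq// big_filter big_enum_cond/=.
  under eq_bigr do rewrite PA.
  by rewrite sumEFin; congr (_%:E); apply: eq_bigl => k; rewrite ?inE.
have DE : (P (\bigcup_(k in [set` D]) A k) <= P (~` E))%E.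
  apply: le_measure; rewrite ?inE.
  - exact: fin_bigcup_measurable.
  - exact: measurableC.
  - move=> w [k /= kD Akw] Ew.
    have Qk : Q k by apply: AQ; exists w.
    by move: kD; rewrite mem_filter Qk.
rewrite -[E]setCK probability_setC; last exact: measurableC.
have mP : measurable (~` E) by exact: measurableC.
have Pfin : P (~` E) \is a fin_num by exact: fin_num_measure.
rewrite -(fineK Pfin) -EFinB lee_fin.
move: DE; rewrite PD -(fineK Pfin) lee_fin => DE.
have split1 : 1 = \sum_(k | Q k) p + \sum_(k | ~~ Q k) p.
  by rewrite -Kp mulr_natl -sumr_const (bigID Q).
lra.
Qed.

Definition sign_tuple n (s : {ffun 'I_n -> bool}) : n.-tuple R :=
  [tuple sg R (s i) | i < n].

Lemma sg_inj : injective (sg R).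
Proof.
have h : (1 : R) != -1 by apply/eqP => h; lra.
move=> [] [] //; rewrite /sg expr0 expr1 => /eqP.
  by rewrite eq_sym (negbTE h).
by rewrite (negbTE h).
Qed.

Lemma sign_tuple_inj n : injective (@sign_tuple n).
Proof.
move=> s s' /(congr1 (fun u => tnth u)) h; apply/ffunP => i.
by have := congr1 (@^~ i) h; rewrite !tnth_mktuple => /sg_inj.
Qed.

Lemma sign_vectorP n (u : n.-tuple R) : sign_vector u <-> exists s, u = sign_tuple s.
Proof.
split=> [us|[s ->] i]; last first.
  by rewrite tnth_mktuple /sg; case: (s i); [right|left]; rewrite ?expr0 ?expr1.
exists [ffun i => tnth u i == -1]; apply: eq_from_tnth => i.
rewrite tnth_mktuple ffunE /sg; case: eqVneq => [->|]; first by rewrite expr1.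
by case: (us i) => ->; rewrite ?eqxx// expr0.
Qed.

Lemma hamming_sign_tuple n (s s' : {ffun 'I_n -> bool}) :
  hamming (sign_tuple s) (sign_tuple s') = flips s s'.
Proof.
apply: eq_card => i; rewrite !inE !tnth_mktuple.
by rewrite (inj_eq sg_inj).
Qed.

Lemma bilin_sign_tuple n m (M : 'M[R]_(n, m)) s t :
  bilin M (sign_tuple s) (sign_tuple t) = sign_bilin M s t.
Proof.
rewrite /bilin -mulmxA mxE /sign_bilin /dot; apply: eq_bigr => i _.
rewrite mxE tnth_mktuple mulrC; congr (_ * _).
by rewrite mxE; apply: eq_bigr => j _; rewrite mxE tnth_mktuple.
Qed.

(** The infimum in the resilience is attained, since distances are integers. *)
Lemma Res_leP n m (M : 'M[R]_(n, m)) x u v (r : nat) :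
  (Res M x u v <= r%:R%:E)%E <->
  exists p : {ffun 'I_n -> bool} * {ffun 'I_m -> bool},
    sign_bilin M p.1 p.2 = x /\
    (hamming u (sign_tuple p.1) + hamming v (sign_tuple p.2) <= r)%N.
Proof.
split=> [|[[s t] /= [xE hr]]]; last first.
  apply: le_trans (_ : ((hamming u (sign_tuple s) + hamming v (sign_tuple t))%:R%:E <= _)%E).
    apply: ereal_inf_lbound; exists (sign_tuple s), (sign_tuple t); split => //.
    - by apply/sign_vectorP; exists s.
    - by apply/sign_vectorP; exists t.
    - by rewrite bilin_sign_tuple.
  by rewrite lee_fin ler_nat.
apply: contraPP => noP; apply/negP; rewrite -ltNge.
apply: (@lt_le_trans _ _ (r.+1%:R%:E)); first by rewrite lte_fin ltr_nat.
apply: le_ereal_inf_tmp => _ [_ [_ [/sign_vectorP[s ->] /sign_vectorP[t ->] xE ->]]].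
rewrite lee_fin ler_nat ltnNge; apply/negP => hr; apply: noP.
by exists (s, t); split=> //=; rewrite -bilin_sign_tuple.
Qed.

Lemma measurable_hamming d (T : measurableType d) n (X : T -> n.-tuple R) (u : n.-tuple R) :
  measurable_fun setT X -> measurable_fun setT (fun w => (hamming (X w) u)%:R : R).
Proof.
move=> mX.
have mt i : measurable_fun setT (fun w => tnth (X w) i).
  exact: measurableT_comp (measurable_tnth i) mX.
have mU i : measurable (~` [set w | tnth (X w) i = tnth u i]).
  apply: measurableC; rewrite -[X in measurable X]setTI.
  exact: mt (measurable_set1 _).
rewrite (_ : (fun w => _) = (fun w => \sum_(i < n)
    \1_(~` [set w | tnth (X w) i = tnth u i]) w)).
  by apply: measurable_sum => i; exact: measurable_realfun.measurable_indic.
apply/funext => w; rewrite /hamming -sum1_card natr_sum [LHS]big_mkcond/=.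
apply: eq_bigr => i _; rewrite indicE inE/=.
case: (eqVneq (tnth (X w) i) (tnth u i)) => [e|ne] /=.
  by rewrite memNset//= => /(_ e).
by rewrite mem_set//= => e; move: ne; rewrite e eqxx.
Qed.

Lemma measurable_Res_le d (T : measurableType d) n m (M : 'M[R]_(n, m)) x
    (X : T -> n.-tuple R) (Y : T -> m.-tuple R) (r : nat) :
  measurable_fun setT X -> measurable_fun setT Y ->
  measurable [set w | (Res M x (X w) (Y w) <= r%:R%:E)%E].
Proof.
move=> mX mY.
pose F (p : {ffun 'I_n -> bool} * {ffun 'I_m -> bool}) : set T :=
  [set w | (hamming (X w) (sign_tuple p.1))%:R +
    (hamming (Y w) (sign_tuple p.2))%:R <= r%:R :> R].
rewrite (_ : [set w | _] = \bigcup_(p in [set p | sign_bilin M p.1 p.2 = x]) F p).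
  apply: fin_bigcup_measurable; first exact: finite_finset.
  move=> p _; rewrite /F -[X in measurable X]setTI.
  rewrite (_ : [set w | _] = (fun w => (hamming (X w) (sign_tuple p.1))%:R +
    (hamming (Y w) (sign_tuple p.2))%:R) @^-1` [set` `]-oo, (r%:R : R)]]); last first.
    by apply/seteqP; split=> w /=; rewrite in_itv.
  apply: measurable_realfun.measurable_funD => //; exact: measurable_hamming.
apply/seteqP; split=> w /=.
  by move=> /Res_leP[p [pE hr]]; exists p => //; rewrite /F/= -natrD ler_nat.
move=> [p /= pE]; rewrite /F/= -natrD ler_nat => hr.
by apply/Res_leP; exists p.
Qed.

Lemma measurable_point n (s : {ffun 'I_n -> bool}) :
  measurable [set u : n.-tuple R | forall i, tnth u i = sg R (s i)].
Proof.
rewrite (_ : [set u | _] = \bigcap_(i in [set: 'I_n])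
    ((fun u : n.-tuple R => tnth u i) @^-1` [set sg R (s i)])).
  apply: fin_bigcap_measurable => // i _; rewrite -[X in measurable X]setTI.
  exact: measurable_tnth.
by apply/seteqP; split=> u /= h i; [move=> _|]; exact: h.
Qed.

Lemma rademacher_atom d (T : measurableType d) (P : probability T R) n
    (psi : {RV P >-> n.-tuple R}) (s : {ffun 'I_n -> bool}) : rademacher psi ->
  P (psi @^-1` [set u | forall i, tnth u i = sg R (s i)]) = (2^-1 ^+ n)%:E.
Proof.
move=> [ind half].
have := ind [set: 'I_n]%SET (fun i => [set sg R (s i)]).
rewrite (_ : \bigcap_(i in _) _ =
    psi @^-1` [set u | forall i, tnth u i = sg R (s i)]); last first.
  apply/seteqP; split=> w /= h i; last by move=> _; exact: h.
  by apply: h; rewrite /= inE.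
move=> ->//; under eq_bigr => i _.
  rewrite (_ : P _ = (2^-1)%:E); last first.
    have [h1 h2] := half i; rewrite /sg; case: (s i); rewrite ?expr1 ?expr0//.
  over.
by rewrite prodEFin prodr_const cardsT card_ord.
Qed.

Lemma probability_Res_le d (T : measurableType d) (P : probability T R) n m
    (M : 'M[R]_(n, m)) (psi : {RV P >-> n.-tuple R}) (xi : {RV P >-> m.-tuple R})
    (x : R) (r : nat) :
  rademacher psi -> rademacher xi -> independent2 psi xi ->
  (P [set w | (Res M x (psi w) (xi w) <= r%:R%:E)%E] <=
    (mean (fun t => mean (fun s => (reachable M x r s t)%:R)))%:E)%E.
Proof.
move=> rpsi rxi ind.
pose A (p : {ffun 'I_n -> bool} * {ffun 'I_m -> bool}) : set T :=
  psi @^-1` [set u | forall i, tnth u i = sg R (p.1 i)] `&`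
  xi @^-1` [set v | forall j, tnth v j = sg R (p.2 j)].
have AE p w : A p w -> psi w = sign_tuple p.1 /\ xi w = sign_tuple p.2.
  by move=> [h1 h2]; split; apply: eq_from_tnth => i;
    rewrite tnth_mktuple; [exact: h1|exact: h2].
have PA p : P (A p) = (2^-1 ^+ n * 2^-1 ^+ m)%:E.
  rewrite /A ind; [|exact: measurable_point..].
  by rewrite !rademacher_atom.
have card : #|{: {ffun 'I_n -> bool} * {ffun 'I_m -> bool}}|%:R *
    (2^-1 ^+ n * 2^-1 ^+ m) = 1 :> R.
  rewrite card_prod !card_ffun card_bool !card_ord natrM !natrX !exprVn.
  by rewrite mulrACA !mulfV ?mulr1// expf_neq0.
have := @probability_le_atoms _ _ P _ A (fun p => reachable M x r p.1 p.2)
  [set w | (Res M x (psi w) (xi w) <= r%:R%:E)%E] _ _ _ _ PA card.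
move=> H; apply: le_trans (H _ _ _ _) _.
- exact: measurable_Res_le.
- move=> p; apply: measurableI; rewrite -[X in measurable X]setTI.
    by apply: (measurable_funPT psi) => //; exact: measurable_point.
  by apply: (measurable_funPT xi) => //; exact: measurable_point.
- move=> [s t] [s' t'] _ _ [w [/AE/= [a1 a2] /AE/= [b1 b2]]].
  by congr (_, _); apply: sign_tuple_inj; congruence.
- move=> [s t] [w [/AE/= [a1 a2] /= /Res_leP[[s' t'] /= [xE hr]]]].
  apply/existsP; exists s'; apply/existsP; exists t'.
  by rewrite xE eqxx/= -!hamming_sign_tuple -a1 -a2.
rewrite lee_fin big_mkcond/= 
  -(pair_bigA _ (fun s t => if reachable M x r s t then _ else _))/=.
rewrite exchange_big/= /mean -mulr_suml !card_ord -!mulrA mulr_suml.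
apply: eqW; apply: eq_bigr => t _; rewrite mulr_suml; apply: eq_bigr => s _.
by case: ifP; rewrite ?mul0r// mul1r !exprVn.
Qed.

End transfer.

Theorem theorem1p2 (R : realType) :
  exists c1 c2 c3 : R,
    [/\ 0 < c1, 0 < c2, 0 < c3 &
      forall (n m : nat) (M : 'M[R]_(n, m)),
        (0 < n)%N -> (0 < m)%N -> M != 0 ->
      forall (d : measure_display) (T : measurableType d)
        (P : probability T R)
        (psi : {RV P >-> n.-tuple R}) (xi : {RV P >-> m.-tuple R}),
        rademacher psi -> rademacher xi -> independent2 psi xi ->
      forall r : nat, (1 <= r <= n)%N ->
        (ereal_sup [set P [set w | (Res M x (psi w) (xi w) <= r%:R%:E)%E]
                    | x in [set: R]]
         <= (c1 * r%:R * f_param M n + c2 * r%:R * g_param M r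
             + expR (- c3 * stable_rank M))%:E)%E].
Proof.
exists 1032, 512, (1 / 8); split; [by lra|by lra|by lra|].
move=> n m M n0 m0 M0 d T P psi xi rpsi rxi ind r rn.
apply: ge_ereal_sup => _ [x _ <-].
apply: le_trans (probability_Res_le M x r rpsi rxi ind) _.
by rewrite lee_fin mean_reachable.
Qed.
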